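(* Let $E/F$ be a cyclic (Galois) field extension of degree $n$ with $\mathrm{Gal}(E/F)=\langle\sigma\rangle$ and $\mathrm{char}(F)=p>0$. Let $n_p$ be the $p$-part of $n$, i.e. the power of $p$ with $n_p\mid n$ and $pn_p\nmid n$. Let $y\in E$ satisfy $\mathrm{Tr}^E_F(y)=0$. Then: (a) for every $z\in E$ with $\mathrm{Tr}^E_F(z)=1$, the field $F(z)$ contains the fixed field of $\sigma^{n_p}$ in $E$; moreover, there exists $z\in E$ with $\mathrm{Tr}^E_F(z)=1$ and $|F(z):F|=n_p$; (b) for every $z\in E$ with $\mathrm{Tr}^E_F(z)=1$, setting $e=|F(z):F|$, we have $n_p\mid e$ and the sequence $\left(\sum_{j=0}^{i-1}\sigma^j z\right)_{i\ge 0}$ is periodic with period $pe$.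
   Context: A cyclic extension $E/F$ of degree $n$ is a finite Galois extension whose Galois group is cyclic of order $n$. The trace map is $\mathrm{Tr}^E_F(y)=\sum_{i=0}^{n-1}\sigma^i y$. Empty sums are $0$. A sequence $(x_i)_{i\ge0}$ has period $m$ if $x_i=x_j$ whenever $i\equiv j\pmod m$, and $m$ is the minimal positive integer with this property. *)

(* Defs.v *)
From mathcomp Require Import all_boot all_order all_fingroup all_algebra.
From mathcomp Require Import all_solvable all_field.
Set Implicit Arguments.
Unset Strict Implicit.
Unset Printing Implicit Defensive.

Definition period_rule (T : Type) (x : nat -> T) (m : nat) : Prop :=
  forall i j : nat, i = j %[mod m] -> x i = x j.

Definition has_period (T : Type) (x : nat -> T) (m : nat) : Prop :=
  [/\ 0 < m, period_rule x m &
      forall m' : nat, 0 < m' -> period_rule x m' -> m <= m'].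

(* Main.v *)
(* Put e = [F(z) : F] and x_i = sum_(j < i) sigma^j z.  Since F(z) is the fixed
   field of sigma^e, the terms sigma^j z are e-periodic, so Tr z = (n / e) x_e.
   If Tr z = 1 then p does not divide n / e, whence n_p | e, and x_e <> 0;
   moreover x_(k e) = k x_e vanishes exactly when p | k, which gives the period
   p e. *)
Require Import Defs.
From mathcomp Require Import all_boot all_order all_fingroup all_algebra.
From mathcomp Require Import all_solvable all_field.
Import GRing.Theory.
Local Open Scope ring_scope.

Lemma big_cycle {gT : finGroupType} {V : nmodType} (a : gT) (f : gT -> V) :
  \sum_(x in <[a]>%g) f x = \sum_(i < #[a]%g) f (a ^+ i)%g.
Proof.
rewrite (_ : <[a]>%g = [set (a ^+ val i)%g | i in 'I_#[a]%g]); last first.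
  apply/setP=> x; apply/idP/imsetP => [/cyclePmin[i lt_ia ->]|[i _ ->]].
    by exists (Ordinal lt_ia).
  exact: mem_cycle.
rewrite big_imset //= => i j _ _ /eqP.
by rewrite eq_expg_mod_order !modn_small // => /eqP/val_inj.
Qed.

(** Exponents of [a] matter only modulo [#[a]], and since [e] divides [#[a]], reduction modulo
    [#[a]] does not affect divisibility by [e]. *)
Lemma mem_cycleX {gT : finGroupType} (a : gT) (e m : nat) :
  (e %| #[a]%g)%N -> (a ^+ m \in <[a ^+ e]>)%g = (e %| m)%N.
Proof.
move=> e_a; apply/cycleP/idP=> [[k]|/dvdnP[k ->]]; last first.
  by exists k; rewrite -expgM mulnC.
rewrite -expgM => /eqP; rewrite eq_expg_mod_order => /eqP eq_mk.
have dvd_mod i : (e %| i %% #[a]%g)%N = (e %| i)%N.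
  by rewrite {2}(divn_eq i #[a]%g) dvdn_addr // dvdn_mull.
by rewrite -dvd_mod eq_mk dvd_mod dvdn_mulr.
Qed.

Lemma sum_periodic {V : nmodType} (f : nat -> V) (e k : nat) :
  (forall i, f (e + i)%N = f i) ->
  \sum_(i < k * e) f i = (\sum_(i < e) f i) *+ k.
Proof.
move=> fe; elim: k => [|k IHk]; first by rewrite big_ord0.
rewrite mulSn big_split_ord /= mulrS -IHk; congr (_ + _).
by apply: eq_bigr => i _.
Qed.

Lemma period_ruleP {T : Type} (x : nat -> T) (m : nat) :
  (forall i, x (m + i)%N = x i) <-> period_rule x m.
Proof.
split=> [xm i j eq_ij | xm i]; last by apply: xm; rewrite modnDl.
have x_mod k : x k = x (k %% m)%N.
  rewrite {1}(divn_eq k m); elim: (k %/ m)%N => // q IHq.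
  by rewrite mulSn -addnA xm.
by rewrite x_mod eq_ij -x_mod.
Qed.

Section CyclicExtension.

Context {F : fieldType} {E : splittingFieldType F}.
Hypothesis galE : galois 1%VS {:E}%VS.
Context {s : gal_of {:E}%VS}.
Hypothesis genE : 'Gal({:E}%VS / 1%VS)%g = <[s]>%g.
Local Notation Tr := (galTrace 1%VS {:E}%VS).
Local Notation deg z := (\dim <<1%VS; z>>%VS).

Lemma order_cyclic_gen : #[s]%g = \dim {:E}.
Proof. by rewrite /order -genE -(galois_dim galE) dimv1 divn1. Qed.

Lemma deg_dvd_order (z : E) : (deg z %| #[s]%g)%N.
Proof. by rewrite order_cyclic_gen field_dimS ?subvf. Qed.

(* The subgroups of a cyclic group are determined by their orders. *)
Lemma Gal_Fadjoin_cyclic (z : E) :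
  'Gal({:E}%VS / <<1%VS; z>>%VS)%g = <[s ^+ deg z]>%g.
Proof.
set K := <<1%VS; z>>%AS.
have galK : galois K {:E} by apply: galoisS galE; rewrite sub1v subvf.
apply/eqP; rewrite (eq_subG_cyclic (cycle_cyclic s)) ?cycleX //.
  rewrite -[#|<[_]>%g|]/#[s ^+ \dim K]%g orderXdiv ?deg_dvd_order //.
  by rewrite order_cyclic_gen -(galois_dim galK).
by rewrite /= -genE galS ?sub1v.
Qed.

Lemma fixedField_cyclic_Fadjoin (z : E) :
  fixedField [set (s ^+ deg z)%g] = <<1%VS; z>>%VS.
Proof.
have galK : galois <<1%VS; z>>%AS {:E}.
  by apply: galoisS galE; rewrite sub1v subvf.
rewrite -{2}(galois_fixedField galK) Gal_Fadjoin_cyclic.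
(* A set of automorphisms and the group it generates have the same fixed field, so the singleton may
   replace the cyclic group. *)
by rewrite /cycle -gal_generated (galois_fixedField (fixedField_galois _)).
Qed.

Lemma mem_fixedField1 (x : gal_of {:E}%VS) (z : E) :
  (z \in fixedField [set x]) = (x z == z).
Proof.
apply/(fixedFieldP (memvf z))/eqP=> [-> //|xz y]; first exact: set11.
by move/set1P->.
Qed.

(** Fixing [z] amounts to fixing F(z), i.e. to lying in its Galois group [<[s ^+ deg z]>]. This
    turns every later question about degrees into one about which powers of [s] fix [z]. *)
Lemma galX_fixed (z : E) (m : nat) : ((s ^+ m)%g z == z) = (deg z %| m)%N.
Proof.
rewrite -(mem_cycleX s) ?deg_dvd_order // -Gal_Fadjoin_cyclic.
apply/idP/idP => [sz | sm]; last first.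
  by apply/eqP/(fixed_gal _ sm); rewrite ?subvf // memv_adjoin.
have sub_fix : (<<1%AS; z>> <= fixedField [set (s ^+ m)%g])%VS.
  by apply/FadjoinP; rewrite sub1v mem_fixedField1.
apply: (subsetP (galS _ sub_fix)).
by rewrite gal_generated mem_gen ?set11.
Qed.

Lemma fixedFieldX_sub (d e : nat) :
  (d %| e)%N -> (fixedField [set (s ^+ d)%g] <= fixedField [set (s ^+ e)%g])%VS.
Proof.
case/dvdnP=> k ->; apply/subvP=> z; rewrite !mem_fixedField1 !galX_fixed.
exact: dvdn_mull.
Qed.

Lemma galXD (i j : nat) (z : E) : (s ^+ (i + j))%g z = (s ^+ j)%g ((s ^+ i)%g z).
Proof. by rewrite expgD galM ?memvf. Qed.

Lemma galX_deg_periodic (z : E) (i : nat) : (s ^+ (deg z + i))%g z = (s ^+ i)%g z.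
Proof. by rewrite galXD; congr (fun_of_lfun _ _); apply/eqP; rewrite galX_fixed. Qed.

Lemma Tr_deg (z : E) :
  Tr z = (\sum_(i < deg z) (s ^+ i)%g z) *+ (\dim {:E} %/ deg z).
Proof.
rewrite /galTrace genE (big_cycle s (fun x : gal_of _ => x z)).
rewrite order_cyclic_gen -(sum_periodic (fun i => (s ^+ i)%g z)).
  by rewrite divnK // -order_cyclic_gen deg_dvd_order.
exact: galX_deg_periodic.
Qed.

Lemma TrZ (c : F) (z : E) : Tr (c *: z) = c *: Tr z.
Proof. by rewrite /galTrace scaler_sumr; apply: eq_bigr => x _; rewrite linearZ. Qed.

Lemma Tr_scale (z : E) : Tr z != 0 -> exists2 c, c != 0 & Tr (c *: z) = 1.
Proof.
have /vlineP[c Trz] := mem_galTrace galE (memvf z).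
rewrite Trz scaler_eq0 oner_eq0 orbF => c0; exists c^-1; first exact: invr_neq0.
by rewrite TrZ Trz scalerA mulVf // scale1r.
Qed.

(** [Tr] is additive and invariant under each conjugation by Gal(E/K), a subgroup of Gal(E/F), so
    every term of the relative trace contributes [Tr u]. *)
Lemma Tr_galTrace (K : {subfield E}) (u : E) :
  Tr (galTrace K {:E} u) = Tr u *+ #|'Gal({:E} / K)%g|.
Proof.
rewrite {2}/galTrace raddf_sum /= -sumr_const; apply: eq_bigr => x Gx.
by rewrite galTrace_gal ?memvf // (subsetP (galS _ (sub1v K))).
Qed.

(** Dedekind independence of automorphisms: the combination with all coefficients 1 is not
    identically zero. *)
Lemma Tr_neq0 : exists u, Tr u != 0.
Proof.
have [u _ Tu] := @gal_independent_contra _ E {:E}%AS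
  [in 'Gal({:E} / 1)%g] (fun=> 1) 1%g (group1 _) (oner_neq0 _).
by exists u; move: Tu; under eq_bigr do rewrite mul1r.
Qed.

Context {p : nat}.
Hypothesis charF : p \in [pchar F].

Let charE : p \in [pchar E]. Proof. by rewrite pchar_lalg. Qed.

Lemma partn_dvd_deg (z : E) : Tr z = 1 -> ((\dim {:E})`_p %| deg z)%N.
Proof.
move=> Tz; have p_pr := pcharf_prime charF.
have e_n : (deg z %| \dim {:E})%N by rewrite field_dimS ?subvf.
have n_gt0 : (0 < \dim {:E})%N by rewrite adim_gt0.
have pNk : ~~ (p %| \dim {:E} %/ deg z)%N.
  rewrite (dvdn_pcharf charE); apply: contraTneq isT => k0.
  have := Tr_deg z; rewrite Tz -mulr_natr k0 mulr0 => /eqP.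
  by rewrite oner_eq0.
move: n_gt0 pNk; rewrite -{1 3}(divnK e_n); move: (_ %/ _)%N => k.
rewrite muln_gt0 => /andP[k_gt0 e_gt0] pNk.
(* With n = k e and p not dividing k, the p-parts of n and e coincide. *)
by rewrite partnM // [(k`_p)%N]part_p'nat ?mul1n ?dvdn_part // p'natE.
Qed.

Lemma fixedField_partn_sub (z : E) :
  Tr z = 1 -> (fixedField [set (s ^+ ((\dim {:E})`_p)%N)%g] <= <<1%VS; z>>)%VS.
Proof.
by move=> Tz; rewrite -fixedField_cyclic_Fadjoin fixedFieldX_sub ?partn_dvd_deg.
Qed.

(* Descend an element of nonzero trace to the fixed field K of [s ^+ n_p] by
   the relative trace; this multiplies Tr by [E : K] = n / n_p, which is prime
   to p. *)
Lemma Tr1_deg_partn : exists z, Tr z = 1 /\ deg z = ((\dim {:E})`_p)%N.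
Proof.
set n := \dim {:E}; pose q := (n`_p)%N; have p_pr := pcharf_prime charF.
have n_gt0 : (0 < n)%N by rewrite adim_gt0.
pose K : {subfield E} := [aspace of fixedField [set (s ^+ q)%g]].
have cardK : #|'Gal({:E} / K)%g| = (n`_p^')%N.
  rewrite gal_generated -[#|_|]/#[s ^+ q]%g orderXdiv order_cyclic_gen ?dvdn_part //.
  by rewrite -/n -[X in (X %/ _)%N](partnC p n_gt0) mulKn ?part_gt0.
have [u Tu] := Tr_neq0; pose v := galTrace K {:E} u.
have /Tr_scale[c c0 Tz] : Tr v != 0.
  rewrite Tr_galTrace cardK -mulr_natr mulf_neq0 // -(dvdn_pcharf charE).
  by rewrite -p'natE ?part_pnat ?part_gt0.
have /eqP vq : (s ^+ q)%g v == v.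
  rewrite -mem_fixedField1 mem_galTrace ?memvf //; exact: fixedField_galois.
(* Trace 1 forces n_p to divide the degree; conversely [s ^+ q] fixes [c *: v], so the degree
   divides [q]. *)
exists (c *: v); split=> //; apply/eqP; rewrite eqn_dvd partn_dvd_deg // andbT.
by rewrite -galX_fixed linearZ /= vq.
Qed.

Lemma has_period_partial_Tr (z : E) :
  Tr z = 1 -> has_period (fun i => \sum_(j < i) (s ^+ j)%g z) (p * deg z).
Proof.
set x := fun i => _; move=> Tz.
have e_gt0 : (0 < deg z)%N by rewrite adim_gt0.
have xk k : x (k * deg z)%N = x (deg z) *+ k.
  exact: sum_periodic (galX_deg_periodic z).
have xe0 : x (deg z) != 0.
  apply: contraTneq isT => xe0; have := Tr_deg z; rewrite Tz -/(x _) xe0 mul0rn.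
  by move/eqP; rewrite oner_eq0.
have x0 : x 0 = 0 by rewrite /x big_ord0.
have xk0 k : (x (k * deg z)%N == 0) = (p %| k)%N.
  by rewrite xk -mulr_natr mulf_eq0 (negPf xe0) (dvdn_pcharf charE).
have xS i : x i.+1 = x i + (s ^+ i)%g z by rewrite /x big_ord_recr.
split=> [|| m m_gt0 /period_ruleP xm].
- by rewrite muln_gt0 (prime_gt0 (pcharf_prime charF)).
(* The increments [(s ^+ i) z] are already e-periodic, so it suffices that x_(pe) = p x_e = 0 =
   x_0. *)
- apply/period_ruleP; elim=> [|i IHi].
    by rewrite addn0 x0; apply/eqP; rewrite xk0.
  rewrite addnS !xS IHi galXD; congr (_ + (s ^+ i)%g _).
  by apply/eqP; rewrite galX_fixed dvdn_mull.
have xm0 : x m = 0 by rewrite -[m]addn0 xm.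
(* Comparing x_(m+1) = x_1 with x_m = x_0 = 0 yields [(s ^+ m) z = z], hence e divides [m]. *)
have /dvdnP[k m_eq] : (deg z %| m)%N.
  rewrite -galX_fixed; apply/eqP/(addrI (x m)).
  by rewrite -xS -addn1 xm xm0 add0r xS x0 add0r gal_id.
(* Minimality comes from divisibility: with m = k e, the vanishing of x_m gives p | k. *)
apply: dvdn_leq => //; rewrite m_eq dvdn_pmul2r //.
by rewrite -xk0 -m_eq xm0.
Qed.

End CyclicExtension.

Theorem theorem1p2 (F : fieldType) (E : splittingFieldType F)
  (galEF : galois 1%VS {:E}%VS)
  (n : nat) (degEF : n = \dim {:E}%VS)
  (sigma : gal_of {:E}%VS)
  (sigma_gen : 'Gal({:E}%VS / 1%VS)%g = <[sigma]>%g)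
  (p : nat) (charF : p \in [pchar F])
  (y : E) (trace_y : galTrace 1%VS {:E}%VS y = 0) :
  ((forall z : E, galTrace 1%VS {:E}%VS z = 1 ->
      (fixedField [set (sigma ^+ (n`_p)%N)%g] <= <<1%VS; z>>)%VS)
   /\ (exists z : E, galTrace 1%VS {:E}%VS z = 1
                     /\ \dim <<1%VS; z>>%VS = (n`_p)%N))
  /\ (forall z : E, galTrace 1%VS {:E}%VS z = 1 ->
        ((n`_p)%N %| \dim <<1%VS; z>>%VS)%N
        /\ has_period (fun i : nat => \sum_(j < i) (sigma ^+ j)%g z)
                      (p * \dim <<1%VS; z>>%VS)%N).
Proof.
rewrite degEF; split; [split|] => [z Tz||z Tz].
- exact: fixedField_partn_sub.
- exact: (Tr1_deg_partn galEF sigma_gen).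
split; last exact: has_period_partial_Tr.
exact: (partn_dvd_deg galEF sigma_gen charF).
Qed.
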